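(* Let $\Bbbk$ be a field, $R=\Bbbk[x_1,\dots,x_n]$, and let $I=\langle m_1,\dots,m_r\rangle\subseteq R$ be a monomial ideal given by an ordered list of monomial generators. Let $\mathcal{A}_P\subseteq E_{X_{\mathrm{Taylor}}}$ be the set of pruned edges returned by the pruning algorithm (described in the context) applied to the Taylor complex of $m_1,\dots,m_r$. Then the $\mathbb{Z}^n$-graded CW-complex $(X_{\mathcal{A}_P},gr)$ supports a cellular free resolution $\mathbb{F}_\bullet^{(X_{\mathcal{A}_P},gr)}$ of $R/I$.
   Context: Taylor complex. For $\sigma\in\{0,1\}^r$ put $m_\sigma=\mathrm{lcm}(m_i\mid \sigma_i=1)$, and let $\varepsilon_1,\dots,\varepsilon_r$ be the standard basis of $\mathbb{Z}^r$. $X_{\mathrm{Taylor}}$ is the full simplex on $r$ vertices; its faces are labelled by $\sigma\in\{0,1\}^r$ (the face $\{i\mid\sigma_i=1\}$, of dimension $\sum_i\sigma_i-1$), and it is $\mathbb{Z}^n$-graded by $gr(\sigma)=\alpha$, where $\mathbf{x}^\alpha=m_\sigma$. $E_{X_{\mathrm{Taylor}}}$ is the set of directed edges $\sigma\to\sigma'$ with $\sigma'\le\sigma$ and $\dim\sigma'=\dim\sigma-1$. Pruning algorithm. For $j=1,\dots,r$ in this order, step $(j)$: for all $\sigma\in\{0,1\}^r$ with $\sigma_j=0$, prune the edge $\sigma+\varepsilon_j\to\sigma$ if it survived after step $(j-1)$ and $gr(\sigma)=gr(\sigma+\varepsilon_j)$. Pruning an edge means removing it together with its two vertices and all edges passing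 through these two vertices. The output $\mathcal{A}_P$ is the set of all pruned edges. Matchings and discrete Morse theory. For a regular $\mathbb{Z}^n$-graded CW-complex $(X,gr)$, with $gr$ an order-preserving map from the poset of cells to $\mathbb{Z}_{\ge0}^n$, let $G_X$ be the directed graph on the cells of $X$ with edge set $E_X=\{\sigma\to\sigma'\mid\sigma'\le\sigma,\ \dim\sigma'=\dim\sigma-1\}$. A set $\mathcal{A}\subseteq E_X$ is a matching if each cell occurs in at most one edge of $\mathcal{A}$; it is acyclic if the graph $G_X^{\mathcal{A}}$ obtained by reversing the edges in $\mathcal{A}$ has no directed cycle; it is homogeneous if $gr(\sigma)=gr(\sigma')$ for each $\sigma\to\sigma'\in\mathcal{A}$. The $\mathcal{A}$-critical cells are the cells contained in no edge of $\mathcal{A}$. For a homogeneous acyclic matching $\mathcal{A}$, $X_{\mathcal{A}}$ denotes the (not necessarily regular) Morse CW-complex of discrete Morse theory: its $i$-cells are in one-to-one correspondence with the $\mathcal{A}$-critical $i$-cells of $X$, it is homotopy equivalent to $X$, it inherits the grading $gr$, and its cellular boundary coefficients are given by summing the weights of the directed (gradient) paths in $G_X^{\mathcal{A}}$ between critical cells. Cellular resolution. A $\mathbb{Z}^n$-graded CW-complex $(X,gr)$ supports a cellular free resolution $\mathbb{F}_\bullet^{(X,gr)}$ of $R/I$ if there is a $\mathbb{Z}^n$-graded free resolution of $R/I$ with $F_0=R$ such that, for $i\ge1$, $F_i$ has a basis $\{e_\sigma\}$ indexed by the $(i-1)$-cells of $X$ with $e_\sigma$ in degree $gr(\sigma)$,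 and the differential is $e_\sigma\mapsto\sum_{\sigma'}[\sigma:\sigma']\,\mathbf{x}^{gr(\sigma)-gr(\sigma')}e_{\sigma'}$, where the sum is over the cells $\sigma'\le\sigma$ of dimension one less and $[\sigma:\sigma']$ is the coefficient of $\sigma'$ in the cellular boundary of $\sigma$ (the empty cell, of degree $0$, corresponding to the basis element of $F_0$). *)

(* Defs.v *)
From HB Require Import structures.
From mathcomp Require Import all_boot all_order all_algebra.
From mathcomp Require Export mpoly.

Set Implicit Arguments.
Unset Strict Implicit.
Unset Printing Implicit Defensive.

Import GRing.Theory.

Local Open Scope ring_scope.

(* The combinatorial data of a Z^n-graded CW-complex that enter a cellular
   resolution. The empty cell is not a cell: it is adjoined in [acell] below.
   [face t s] means that t lies in the closure of s, and [inc s t] is the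
   coefficient [s : t] of t in the cellular boundary of s. *)
Record gcw (n : nat) := Gcw {
  cell : finType;
  cdim : cell -> nat;
  face : rel cell;
  gr   : cell -> 'X_{1..n};
  inc  : cell -> cell -> int
}.

Definition order_preserving n (X : gcw n) : Prop :=
  forall s t : cell X, face t s -> (gr t <= gr s)%MM.

Section Morse.
Variables (n : nat) (X : gcw n).

(* The pair (s, t) stands for the directed edge s -> t. *)
Definition edge : finType := (cell X * cell X)%type.

Definition cw_edges : {set edge} :=
  [set e : edge | face e.2 e.1 && (cdim e.1 == (cdim e.2).+1)].

Definition on_edge (c : cell X) (e : edge) : bool := (c == e.1) || (c == e.2).

Definition is_matching (A : {set edge}) : Prop :=
  A \subset cw_edges /\
  forall c : cell X, (#|[set e in A | on_edge c e]| <= 1)%N.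

Definition morse_graph (A : {set edge}) : rel (cell X) := fun s t =>
  ((s, t) \in cw_edges :\: A) || ((t, s) \in A).

Definition acyclic (A : {set edge}) : Prop :=
  forall p : seq (cell X), cycle (morse_graph A) p -> p = [::].

Definition homogeneous (A : {set edge}) : Prop :=
  forall e : edge, e \in A -> gr e.1 = gr e.2.

Definition critical (A : {set edge}) (c : cell X) : bool :=
  [forall e in A, ~~ on_edge c e].

(* A reversed edge t -> s, with s -> t in A, has weight - 1 / [s : t]; the
   inverse is taken in int, where [s : t] = 1 or -1 when X is regular. *)
Definition edge_weight (A : {set edge}) (s t : cell X) : int :=
  if (t, s) \in A then - (inc t s)^-1 else inc s t.

Fixpoint path_weight (A : {set edge}) (s : cell X) (p : seq (cell X)) : int :=
  if p is t :: p' then edge_weight A s t * path_weight A t p' else 1.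

(* Directed paths s -> p_1 -> ... -> p_l = t. When A is acyclic a path has no
   repeated vertex, so the bound l < #|cell X| loses no path. *)
Definition morse_inc (A : {set edge}) (s t : cell X) : int :=
  \sum_(l < #|cell X|)
    \sum_(p : l.-tuple (cell X) | path (morse_graph A) s p && (last s p == t))
      path_weight A s p.

(* Meaningful when A is a homogeneous acyclic matching. *)
Definition morse_complex (A : {set edge}) : gcw n :=
  {| cell := {c : cell X | critical A c};
     cdim := fun c => cdim (val c);
     face := fun t s => connect (morse_graph A) (val s) (val t);
     gr   := fun c => gr (val c);
     inc  := fun s t => morse_inc A (val s) (val t) |}.

End Morse.

(* A complex of free modules F_i over k[x_1, ..., x_n] with F_i = R^(B i), the
   basis element b of F_i being placed in degree deg b; D i b b' is the
   coefficient of b' in the image of b under F_(i+1) -> F_i. *)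
Section FreeComplex.
Variables (k : fieldType) (n : nat) (B : nat -> finType).
Variable deg : forall i, B i -> 'X_{1..n}.
Variable D : forall i, B i.+1 -> B i -> {mpoly k[n]}.

Definition free_mod (i : nat) := {ffun B i -> {mpoly k[n]}}.

Definition diff (i : nat) (u : free_mod i.+1) : free_mod i :=
  [ffun b' => \sum_b u b * D b b'].

Definition graded_diff : Prop :=
  forall i (b : B i.+1) (b' : B i) (a : 'X_{1..n}),
    a \in msupp (D b b') -> (a + deg b')%MM = deg b.

(* F_0 = R sits in degree 0, and ... -> F_1 -> F_0 -> R / I -> 0 is exact. *)
Definition graded_free_resolution (I : {mpoly k[n]} -> Prop) : Prop :=
  [/\ graded_diff,
      exists b0 : B 0%N,
        [/\ forall b, b = b0,
            deg b0 = 0%MM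
          & forall f, I f <-> exists u : free_mod 1, diff u b0 = f]
    & forall i (u : free_mod i.+1),
        diff u = 0 <-> exists w : free_mod i.+2, diff w = u].

End FreeComplex.

Section Cellular.
Variables (k : fieldType) (n : nat) (X : gcw n).

(* The cells of X together with the empty cell None; [adim] is dimension + 1,
   so that F_i has a basis indexed by the augmented cells with adim = i. *)
Definition acell : finType := option (cell X).

Definition adim (c : acell) : nat := if c is Some s then (cdim s).+1 else 0%N.

Definition agr (c : acell) : 'X_{1..n} := if c is Some s then gr s else 0%MM.

Definition aface (c' c : acell) : bool :=
  match c', c with
  | Some t, Some s => face t s
  | None, _ => true
  | Some _, None => false
  end.

(* The empty cell has coefficient 1 in the boundary of each vertex. *)
Definition ainc (c c' : acell) : int :=
  match c, c' with
  | Some s, Some t => inc s t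
  | Some _, None => 1
  | None, _ => 0
  end.

Definition cell_basis (i : nat) : finType := {c : acell | adim c == i}.

Definition cell_deg (i : nat) (c : cell_basis i) : 'X_{1..n} := agr (val c).

Definition cell_diff (i : nat) (c : cell_basis i.+1) (c' : cell_basis i) :
    {mpoly k[n]} :=
  if aface (val c') (val c)
  then (ainc (val c) (val c'))%:~R *: 'X_[(agr (val c) - agr (val c'))%MM]
  else 0.

Definition supports_cellular_resolution (I : {mpoly k[n]} -> Prop) : Prop :=
  graded_free_resolution cell_deg cell_diff I.

End Cellular.

Definition monomial_ideal (k : fieldType) n r (m : r.-tuple 'X_{1..n})
    (f : {mpoly k[n]}) : Prop :=
  exists c : 'I_r -> {mpoly k[n]}, f = \sum_(i < r) c i * 'X_[tnth m i].

Section Taylor.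
Variables (n r : nat) (m : r.-tuple 'X_{1..n}).

Definition lcm_label (s : {set 'I_r}) : 'X_{1..n} :=
  \big[@mlcm n/0%MM]_(i in s) tnth m i.

Definition simplex_inc (s t : {set 'I_r}) : int :=
  \sum_(i in s | t == s :\ i) (-1) ^+ #|[set j in s | (j < i)%N]|.

(* sigma in {0,1}^r is encoded by the set of the i with sigma_i = 1. *)
Definition taylor : gcw n :=
  {| cell := {s : {set 'I_r} | s != set0};
     cdim := fun s => #|val s|.-1;
     face := fun t s => val t \subset val s;
     gr   := fun s => lcm_label (val s);
     inc  := fun s t => simplex_inc (val s) (val t) |}.

(* The pruning algorithm. The state is the pair (surviving edges, pruned
   edges). Since cells are nonempty, the edges from a vertex to the empty cell
   never take part; those would be prunable only if some m_j = 1, and then the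
   empty cell, which spans F_0 = R, would be lost. *)
Definition prunable (S : {set edge taylor}) (j : 'I_r) : {set edge taylor} :=
  [set e in S | [&& j \notin val e.2, val e.1 == j |: val e.2
                  & gr e.2 == gr e.1]].

Definition prune_step (st : {set edge taylor} * {set edge taylor}) (j : 'I_r) :=
  let P := prunable st.1 j in
  ([set e in st.1 | [forall e' in P, ~~ on_edge e.1 e' && ~~ on_edge e.2 e']],
   st.2 :|: P).

Definition pruned_edges : {set edge taylor} :=
  (foldl prune_step (cw_edges taylor, set0) (enum 'I_r)).2.

End Taylor.

(* Main.v *)
Require Import Defs.
From mathcomp Require Import all_boot all_order all_algebra.

(** The Taylor complex is a resolution, and every step of the pruning algorithm
    cancels pairs of basis elements joined by a unit coefficient.  The proof has
    three independent ingredients.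

    Discrete Morse theory.  Let A be an acyclic homogeneous matching on X whose
    matched incidences are units, and split the cells into the upper ends of
    the matched edges, the lower ends, and the critical cells.  Acyclicity makes
    the block of the differential from upper to lower ends triangular with units
    on the diagonal, hence invertible ([top_inj], [bot_onto]).  A chain on
    critical cells therefore has exactly one extension by upper ends whose
    boundary has no component on lower ends; the coefficients of this extension
    are the sums of weights of gradient paths, and the critical part of its
    boundary is the Morse differential ([bdry_lift_incl], [bdry_lift_bot]).
    Cycles and boundaries of the Morse complex are then exactly the chains whose
    extensions are cycles and boundaries of X ([reduced_cycle],
    [reduced_boundary]), so that exactness passes from X to the Morse complex
    ([morse_augmented_resolution]).

    The Taylor complex.  Multiplying the coefficient of a face by its label
    turns the Taylor differential into the simplicial differential with
    coefficients in R ([homogenize_bdry]), which can be studied one monomial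
    x^a at a time.  The faces whose label divides x^a form a full simplex, which
    is contracted by the cone over any vertex i such that m_i divides x^a
    ([cone_homotopy], [taylor_exact]).

    Pruning.  Call j the direction of an edge s -> s \ j.  The algorithm is
    greedy in the direction: an edge of direction j between cells of equal label
    that is not pruned touches a pruned edge of smaller direction.  On a
    directed cycle the label is constant and the two ends of every edge are ends
    of pruned edges of the cycle.  If j is the smallest direction of a pruned
    edge of the cycle, then the vertex j, which that edge adds, has to be
    removed by some other edge of the cycle; this edge has direction j and was
    not pruned, so it touches a pruned edge of smaller direction, which lies on
    the cycle as well: a contradiction ([pruned_acyclic]). *)

Set Implicit Arguments.
Unset Strict Implicit.
Unset Printing Implicit Defensive.

Import GRing.Theory.
Local Open Scope ring_scope.

(** * Augmented cellular chains *)

Lemma sum_sig (V : nmodType) (T : finType) (P : pred T) (F : T -> V) :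
  \sum_(x : {x | P x}) F (val x) = \sum_(x | P x) F x.
Proof.
rewrite [RHS](reindex_omap (val : {x | P x} -> T) insub) => [|x Px]; last first.
  by rewrite insubT.
by apply: eq_bigl => x; rewrite valK eqxx (valP x).
Qed.

Lemma sum_option (V : nmodType) (T : finType) (F : option T -> V) :
  \sum_x F x = F None + \sum_x F (Some x).
Proof.
rewrite (bigD1 None) //=; congr (_ + _).
rewrite (reindex_omap Some id) => [|[x|]] //=.
by apply: eq_bigl => x; rewrite eqxx.
Qed.

Section AugmentedChains.
Variables (k : fieldType) (n : nat).
Implicit Type X : gcw n.
Local Notation R := {mpoly k[n]}.

(** The chain modules of all dimensions are gathered in one module of functions
    on the augmented cells; the dimension test makes the total differential
    homogeneous of degree -1. *)
Definition bdry_coef X (c c' : acell X) : R :=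
  if aface c' c && (adim c == (adim c').+1)
  then (ainc c c')%:~R *: 'X_[(agr c - agr c')%MM] else 0.

Definition bdry X (f : {ffun acell X -> R}) : {ffun acell X -> R} :=
  [ffun c' => \sum_c f c * bdry_coef c c'].

(** The element p of F_0 = R. *)
Definition at_empty X (p : R) : {ffun acell X -> R} :=
  [ffun c => if c is None then p else 0].

Definition augmented_resolution X (I : R -> Prop) : Prop :=
  [/\ forall f : {ffun acell X -> R}, bdry (bdry f) = 0,
      forall f : {ffun acell X -> R},
        f None = 0 -> bdry f = 0 -> exists g, bdry g = f
    & forall p, I p <-> exists g, bdry g = at_empty X p].

Lemma bdryB X : {morph @bdry X : f g / f - g}.
Proof.
move=> f g; apply/ffunP=> c; rewrite !ffunE -sumrB; apply: eq_bigr => s _.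
by rewrite !ffunE mulrBl.
Qed.

Lemma bdry_coefSS X (s t : cell X) : bdry_coef (Some s) (Some t) =
  if (s, t) \in cw_edges X then (inc s t)%:~R *: 'X_[(gr s - gr t)%MM] else 0.
Proof. by rewrite /bdry_coef inE /= eqSS. Qed.

Lemma bdry_coefNS X (t : cell X) : bdry_coef None (Some t) = 0.
Proof. by []. Qed.

Lemma bdry_coefSN X (s : cell X) :
  bdry_coef (Some s) None = if cdim s == 0%N then 'X_[gr s] else 0.
Proof. by rewrite /bdry_coef /= eqSS scale1r subm0. Qed.

Lemma bdryS X (f : {ffun acell X -> R}) t :
  bdry f (Some t) = \sum_s f (Some s) * bdry_coef (Some s) (Some t).
Proof. by rewrite ffunE sum_option bdry_coefNS mulr0 add0r. Qed.

Lemma bdryN X (f : {ffun acell X -> R}) :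
  bdry f None = \sum_s f (Some s) * bdry_coef (Some s) None.
Proof. by rewrite ffunE sum_option /bdry_coef andbF mulr0 add0r. Qed.

Lemma agr_homo X : order_preserving X ->
  forall c c' : acell X, aface c' c -> (agr c' <= agr c)%MM.
Proof.
move=> oX [s|] [t|] //=; first exact: oX.
- by move=> _; apply/mnm_lepP=> i; rewrite mnm0E.
- by move=> _; apply/mnm_lepP.
Qed.

Section HomogeneousParts.
Variable X : gcw n.

Definition restr i (f : {ffun acell X -> R}) :
    free_mod k n (@cell_basis n X) i :=
  [ffun b => f (val b)].

Definition extend i (u : free_mod k n (@cell_basis n X) i) :
    {ffun acell X -> R} :=
  [ffun c => if insub c is Some b then u b else 0].

Lemma extendK i : cancel (@extend i) (@restr i).
Proof. by move=> u; apply/ffunP=> b; rewrite !ffunE valK. Qed.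

Lemma extend_off i (u : free_mod k n (@cell_basis n X) i) c :
  adim c != i -> extend u c = 0.
Proof. by move=> ci; rewrite ffunE insubN. Qed.

Lemma bdry_off i (f : {ffun acell X -> R}) :
  (forall c, adim c != i.+1 -> f c = 0) ->
  forall c, adim c != i -> bdry f c = 0.
Proof.
move=> f0 c ci; rewrite ffunE big1 // => s _; rewrite /bdry_coef.
case: (eqVneq (adim s) i.+1) => [-> | /f0 ->]; last by rewrite mul0r.
by rewrite eqSS [i == _]eq_sym (negPf ci) andbF mulr0.
Qed.

Lemma diff_restr i (f : {ffun acell X -> R}) :
  diff (@cell_diff k n X) (restr i.+1 f) = restr i (bdry f).
Proof.
apply/ffunP=> b; rewrite !ffunE.
rewrite (bigID (fun c => adim c == i.+1)) /= [X in _ + X]big1 => [|c ci].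
  rewrite addr0.
  rewrite -(sum_sig _ (fun c => f c * bdry_coef c (val b))).
  apply: eq_bigr => c _; rewrite ffunE /cell_diff /bdry_coef.
  by rewrite (eqP (valP c)) (eqP (valP b)) eqxx andbT.
by rewrite /bdry_coef (eqP (valP b)) (negPf ci) andbF mulr0.
Qed.

End HomogeneousParts.

(** A homogeneous differential is exact as soon as it is exact in total: the
    part of degree i + 1 of a preimage of a chain of degree i is again a
    preimage. *)
Lemma supports_of_augmented X (I : R -> Prop) :
  order_preserving X -> augmented_resolution X I ->
  supports_cellular_resolution (k := k) X I.
Proof.
move=> oX [dd exX imX]; split.
- move=> i b b' a; rewrite /cell_diff.
  case: ifP => [fb|_]; last by rewrite msupp0.
  move/msuppZ_le; rewrite msuppX inE => /eqP ->.
  by rewrite submK //; apply: agr_homo.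
- have e0 : adim (None : acell X) == 0%N by [].
  exists (exist _ None e0); split=> //.
    by case=> -[c|] h //; apply: val_inj.
  move=> f; rewrite imX; split=> [[g dg] | [u du]].
    by exists (restr 1 g); rewrite diff_restr dg !ffunE.
  exists (extend u); apply/ffunP=> -[c|].
    by rewrite (bdry_off (i := 0)) ?ffunE // => c'; apply: extend_off.
  by rewrite [RHS]ffunE -du -[in RHS](extendK u) diff_restr [RHS]ffunE.
- move=> i u; split=> [du0 | [w <-]]; last first.
    by rewrite -(extendK w) !diff_restr dd; apply/ffunP=> b; rewrite !ffunE.
  have du : bdry (extend u) = 0.
    apply/ffunP=> c; case: (eqVneq (adim c) i) => ci.
      have:= congr1 (fun v : {ffun _} => v (exist _ c (introT eqP ci))) du0.
      by rewrite -{1}(extendK u) diff_restr ffunE => ->; rewrite !ffunE.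
    rewrite (bdry_off (i := i)) ?ffunE //; exact: extend_off.
  have [|g dg] := exX _ _ du; first by rewrite extend_off.
  by exists (restr i.+2 g); rewrite diff_restr dg extendK.
Qed.

End AugmentedChains.

(** * Cancelling an invertible block of a differential *)

(** The classes [top] and [bot] stand for the upper and the lower ends of a
    matching, [C'] for the critical cells, [d'] for the Schur complement of the
    block of [d] from [top] to [bot], and [lft] for the extension of critical
    chains to chains without [bot] component in their boundary. *)
Section Reduction.
Variables (V : zmodType) (C C' : finType) (incl : C' -> C) (top bot : pred C).
Variables (d : {ffun C -> V} -> {ffun C -> V}).
Variables (d' : {ffun C' -> V} -> {ffun C' -> V}).
Variable lft : {ffun C' -> V} -> {ffun C -> V}.
Hypothesis dB : {morph d : f g / f - g}.
Hypothesis dd : forall f, d (d f) = 0.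
Hypothesis coverC : forall c, [\/ exists c', c = incl c', top c | bot c].
Hypothesis inj_top : forall f : {ffun C -> V},
  (forall c, ~~ top c -> f c = 0) ->
  (forall c, bot c -> d f c = 0) -> f = 0.
Hypothesis onto_bot : forall f : {ffun C -> V},
  exists g : {ffun C -> V}, forall c, bot c -> d g c = f c.
Hypothesis lft_incl : forall f c, lft f (incl c) = f c.
Hypothesis lft_bot : forall f c, bot c -> lft f c = 0.
Hypothesis d_lft_incl : forall f c, d (lft f) (incl c) = d' f c.
Hypothesis d_lft_bot : forall f c, bot c -> d (lft f) c = 0.

(** A chain concentrated on [top] is determined by the [bot] part of its
    boundary.  Hence two chains coincide if they agree on critical cells and on
    [bot] and their boundaries agree on [bot]; this is the uniqueness of lifts. *)
Let inj_crit (f : {ffun C -> V}) :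
  (forall c, f (incl c) = 0) -> (forall c, bot c -> f c = 0) ->
  (forall c, bot c -> d f c = 0) -> f = 0.
Proof.
move=> fi fb; apply: inj_top => c tc.
by case: (coverC c) => [[c' ->]| tc' |/fb //]; [apply: fi | rewrite tc' in tc].
Qed.

Lemma reduced_cycle f : d' f = 0 <-> d (lft f) = 0.
Proof.
split=> [df | df]; last by apply/ffunP=> c; rewrite -d_lft_incl df !ffunE.
apply: inj_crit => c; first by rewrite d_lft_incl df ffunE.
  exact: d_lft_bot.
by rewrite dd ffunE.
Qed.

(** From a preimage of a lift one obtains a lift by subtracting a boundary that
    has the same [bot] component. *)
Lemma reduced_boundary f :
  (exists g, d' g = f) <-> (exists g, d g = lft f).
Proof.
split=> [[g dg] | [g dg]].
  exists (lft g); apply/eqP; rewrite -subr_eq0; apply/eqP.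
  apply: inj_crit => c.
  - by rewrite !ffunE d_lft_incl lft_incl dg subrr.
  - by move=> bc; rewrite !ffunE d_lft_bot // lft_bot // subrr.
  - by move=> bc; rewrite dB dd !ffunE d_lft_bot // subrr.
have [h dh] := onto_bot g.
pose z : {ffun C' -> V} := [ffun c => (g - d h) (incl c)].
have gz : g - d h = lft z.
  apply/eqP; rewrite -subr_eq0; apply/eqP; apply: inj_crit => c.
  - by rewrite ffunE [X in _ + X]ffunE lft_incl [z c]ffunE subrr.
  - by move=> bc; rewrite !ffunE dh // lft_bot // !subrr.
  - move=> bc; rewrite !dB dd subr0 dg ffunE lft_bot // ffunE d_lft_bot //.
    by rewrite subr0.
exists z; apply/ffunP=> c.
by rewrite -d_lft_incl -gz dB dd subr0 dg lft_incl.
Qed.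

Lemma reduced_dd f : d' (d' f) = 0.
Proof.
have [g dg] : exists g, d g = lft (d' f).
  by apply/reduced_boundary; exists f.
by apply/reduced_cycle; rewrite -dg dd.
Qed.

End Reduction.

(** * Sums over gradient paths *)

Section GradientPaths.
Variables (n : nat) (X : gcw n) (A : {set edge X}).
Hypothesis matchA : is_matching A.
Hypothesis acyclicA : acyclic A.
Local Notation G := (morse_graph A).

Definition top (c : cell X) : bool := [exists t, (c, t) \in A].
Definition bot (c : cell X) : bool := [exists s, (s, c) \in A].

Lemma matching_uniq c e e' :
  e \in A -> e' \in A -> on_edge c e -> on_edge c e' -> e = e'.
Proof.
move=> eA e'A ce ce'; have [_ /(_ c)/card_le1_eqP] := matchA.
by apply; rewrite inE ?eA ?e'A.
Qed.

Lemma matched_edge s t : (s, t) \in A -> face t s /\ cdim s = (cdim t).+1.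
Proof.
by have [/subsetP sub _] := matchA => /sub; rewrite inE => /andP[-> /eqP].
Qed.

Lemma top_not_bot c : top c -> ~~ bot c.
Proof.
case/existsP=> t ct; apply/existsP=> -[s sc].
have := @matching_uniq c (c, t) (s, c) ct sc; rewrite /on_edge !eqxx ?orbT.
move=> /(_ isT isT) [_ tc]; have [_] := matched_edge ct.
by rewrite tc => /eqP; rewrite eqn_leq ltnn andbF.
Qed.

Lemma criticalE c : critical A c = ~~ top c && ~~ bot c.
Proof.
apply/forallP/andP => [crit | [nt nb] [s t]].
  split; apply/existsP=> -[s sA].
    by have := crit (c, s); rewrite sA /on_edge eqxx.
  by have := crit (s, c); rewrite sA /on_edge eqxx orbT.
apply/implyP=> stA; rewrite /on_edge negb_or /=; apply/andP; split.
  by apply: contra nt => /eqP ->; apply/existsP; exists t.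
by apply: contra nb => /eqP ->; apply/existsP; exists s.
Qed.

(** Counting the reachable cells turns acyclicity into a function that drops
    along every edge. *)
Definition rank (c : cell X) : nat := #|connect G c|.

Lemma rank_lt s t : G s t -> (rank t < rank s)%N.
Proof.
move=> st; apply: proper_card; apply/properP; split.
  by apply/subsetP=> x; apply: connect_trans; apply: connect1.
exists s; first exact: connect0.
apply/negP=> /connectP[p tp sp].
by have /acyclicA : cycle G (t :: p) by rewrite /= rcons_path tp -sp.
Qed.

Lemma rank_gt0 c : (0 < rank c)%N.
Proof. by apply/card_gt0P; exists c; apply: connect0. Qed.

Lemma rank_max c : (rank c <= #|cell X|)%N.
Proof. exact: max_card. Qed.

(** Both kinds of edges of the modified graph respect this function: it is
    constant along a reversed edge, since that leads from a lower end to an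
    upper end one dimension higher.  So a gradient path never exceeds the
    dimension of the critical cell where it starts, and it returns to that
    dimension only at upper ends. *)
Definition depth (c : cell X) : nat := cdim c + bot c.

Lemma depth_step s t : G s t -> (depth t <= depth s)%N.
Proof.
rewrite /depth /morse_graph => /orP[|tsA].
  rewrite !inE => /and3P[_ _ /eqP/= ->].
  by rewrite addSnnS leq_add2l; apply: leq_trans (leq_b1 _) _.
have [_ ->] := matched_edge tsA.
have bs : bot s by apply/existsP; exists t.
have /top_not_bot/negPf -> : top t by apply/existsP; exists s.
by rewrite bs addn0 addn1.
Qed.

Lemma connect_depth s t : connect G s t -> (depth t <= depth s)%N.
Proof.
case/connectP=> p; elim: p s => [|x p IHp] s /= => [_ -> //|].
by case/andP=> /depth_step xs xp /(IHp _ xp) tx; apply: leq_trans xs.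
Qed.

(** The part of [morse_inc] that comes from the paths with l edges. *)
Definition walks l (s t : cell X) : int :=
  \sum_(p : l.-tuple (cell X) | path G s p && (last s p == t))
    path_weight A s p.

(** The weighted adjacency matrix; [walks l] is its l-th power. *)
Definition step (s t : cell X) : int :=
  if G s t then edge_weight A s t else 0.

Lemma walks0 s t : walks 0 s t = (s == t)%:R.
Proof.
rewrite /walks big_mkcond (big_pred1 [tuple]) => [|p]; last first.
  by apply/esym/eqP; apply: tuple0.
by rewrite /=; case: eqP.
Qed.

Lemma walksS l s t : walks l.+1 s t = \sum_y step s y * walks l y t.
Proof.
rewrite /walks.
rewrite (reindex (fun q : cell X * l.-tuple (cell X) => [tuple of q.1 :: q.2])) /=.
  rewrite [LHS]big_mkcond.
  under [RHS]eq_bigr do rewrite big_distrr big_mkcond /=.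
  rewrite [RHS]pair_big /=; apply: eq_bigr => -[y p] _ /=.
  by rewrite /step; case: (G s y) => //=; rewrite mul0r if_same.
exists (fun p => (thead p, [tuple of behead p])) => [[y p] _ | p _] /=.
  by rewrite theadE; congr pair; apply: val_inj.
by rewrite -tuple_eta.
Qed.

Lemma walksSr l s t : walks l.+1 s t = \sum_y walks l s y * step y t.
Proof.
elim: l s => [|l IHl] s.
  rewrite walksS (bigD1 t) //= [RHS](bigD1 s) //= !walks0 !eqxx mul1r mulr1.
  rewrite !big1 // => y ys; rewrite walks0.
    by rewrite eq_sym (negPf ys) mul0r.
  by rewrite (negPf ys) mulr0.
rewrite walksS; under eq_bigr do rewrite IHl big_distrr /=.
rewrite exchange_big; apply: eq_bigr => y _; rewrite walksS big_distrl /=.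
by apply: eq_bigr => x _; rewrite mulrA.
Qed.

Lemma walks_connect l s t : ~~ connect G s t -> walks l s t = 0.
Proof.
move=> st; rewrite /walks big_pred0 // => p; apply: contraNF st.
by case/andP=> sp /eqP <-; apply/connectP; exists p.
Qed.

(** Ranks drop along edges, so the adjacency matrix is nilpotent, and the bound
    on the length of paths in [morse_inc] is harmless. *)
Lemma walks_rank l s t : (rank s < l + rank t)%N -> walks l s t = 0.
Proof.
elim: l s => [|l IHl] s st.
  by rewrite walks0; case: eqP st => // ->; rewrite ltnn.
rewrite walksS big1 // => y _; rewrite /step.
case: ifP => [sy|]; last by rewrite mul0r.
by rewrite IHl ?mulr0 //; apply: leq_trans (rank_lt sy) _; rewrite -ltnS -addSn.
Qed.

Lemma morse_inc_connect s t : ~~ connect G s t -> morse_inc A s t = 0.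
Proof. by move=> st; apply: big1 => l _; apply: walks_connect. Qed.

(** The sum W of the powers of the nilpotent adjacency matrix S satisfies
    W = 1 + W S; this splits off the last edge of a path. *)
Lemma morse_inc_rec s t :
  morse_inc A s t = (s == t)%:R + \sum_y morse_inc A s y * step y t.
Proof.
pose N := #|cell X|.
have -> : morse_inc A s t = \sum_(l < N) walks l s t by [].
have wN : walks N s t = 0.
  apply: walks_rank; apply: leq_ltn_trans (rank_max s) _.
  by rewrite -addn1 leq_add2l rank_gt0.
have <- : \sum_(l < N.+1) walks l s t = \sum_(l < N) walks l s t.
  by rewrite big_ord_recr /= wN addr0.
rewrite big_ord_recl walks0; congr (_ + _).
under eq_bigr do rewrite /= walksSr.
by rewrite exchange_big; apply: eq_bigr => y _; rewrite big_distrl.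
Qed.

Lemma morse_inc_depth s t : (depth s < depth t)%N -> morse_inc A s t = 0.
Proof.
move=> st; apply: morse_inc_connect; apply: contraL st => /connect_depth.
by rewrite -leqNgt.
Qed.

Lemma depth_critical c : critical A c -> depth c = cdim c.
Proof. by rewrite criticalE /depth => /andP[_ /negPf ->]; rewrite addn0. Qed.

Section FromCritical.
Variable c : cell X.
Hypothesis critc : critical A c.

Lemma morse_inc_dim t : (cdim c < cdim t)%N -> morse_inc A c t = 0.
Proof.
move=> ct; apply: morse_inc_depth; rewrite depth_critical //.
exact: leq_trans (leq_addr _ _).
Qed.

Lemma morse_inc_bot t : bot t -> cdim t = cdim c -> morse_inc A c t = 0.
Proof.
move=> bt tc; apply: morse_inc_depth.
by rewrite depth_critical // /depth bt tc addn1.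
Qed.

Lemma step_into_not_top y t : ~~ top t ->
  step y t = if (y, t) \in cw_edges X :\: A then inc y t else 0.
Proof.
move=> nt; have ty : (t, y) \notin A.
  by apply: contra nt => ty; apply/existsP; exists y.
by rewrite /step /morse_graph /edge_weight (negPf ty) orbF.
Qed.

Lemma morse_inc_critical t :
  critical A t -> cdim t = cdim c -> morse_inc A c t = (c == t)%:R.
Proof.
rewrite criticalE => /andP[nt _] tc; rewrite morse_inc_rec big1 ?addr0 // => y _.
rewrite step_into_not_top // !inE /=; case: ifP; last by rewrite mulr0.
by case/and3P=> _ _ /eqP yt; rewrite morse_inc_dim ?mul0r // yt tc.
Qed.

Lemma morse_inc_not_top t : ~~ top t -> cdim c = (cdim t).+1 ->
  morse_inc A c t =
  \sum_(s | (s, t) \in cw_edges X :\: A) morse_inc A c s * inc s t.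
Proof.
move=> nt ct; rewrite morse_inc_rec; case: eqP ct => [-> /eqP|_ _].
  by rewrite eqn_leq ltnn andbF.
rewrite add0r [RHS]big_mkcond; apply: eq_bigr => y _.
by rewrite step_into_not_top //; case: ifP => //; rewrite mulr0.
Qed.

(** Cells above the dimension of c are out of reach, so a path to the upper end
    u arrives through the reversed edge. *)
Lemma morse_inc_matched u t : (u, t) \in A -> cdim c = (cdim t).+1 ->
  morse_inc A c u = - (morse_inc A c t * (inc u t)^-1).
Proof.
move=> utA ct; have [_ ut] := matched_edge utA.
have tu : top u by apply/existsP; exists t.
rewrite morse_inc_rec; case: eqP => [cu | _].
  by move: critc; rewrite criticalE cu tu.
rewrite add0r (bigD1 t) //= big1 => [|y yt].
  by rewrite /step /morse_graph /edge_weight utA orbT addr0 mulrN.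
rewrite /step /morse_graph; have /negPf -> : (u, y) \notin A.
  apply: contra yt => uyA.
  have := @matching_uniq u (u, y) (u, t) uyA utA; rewrite /on_edge eqxx.
  by case/(_ isT isT) => ->.
rewrite orbF !inE /=; case: ifP => [|_]; last by rewrite mulr0.
by case/and3P=> _ _ /eqP yu; rewrite morse_inc_dim ?mul0r // yu ct ut.
Qed.

Lemma lift_boundary_critical t : critical A t -> cdim c = (cdim t).+1 ->
  \sum_(s | (s, t) \in cw_edges X) morse_inc A c s * inc s t = morse_inc A c t.
Proof.
rewrite criticalE => /andP[nt nb] ct; rewrite morse_inc_not_top //.
apply: eq_bigl => s; rewrite in_setD; case: (boolP (_ \in A)) => // stA.
by case/existsP: nb; exists s.
Qed.

(** The path that goes on from t to its partner u contributes the opposite of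
    what the paths ending in t contribute. *)
Lemma lift_boundary_bot t :
  (forall e, e \in A -> inc e.1 e.2 \is a GRing.unit) ->
  bot t -> cdim c = (cdim t).+1 ->
  \sum_(s | (s, t) \in cw_edges X) morse_inc A c s * inc s t = 0.
Proof.
move=> unitA bt ct; have /existsP[u utA] := bt.
have nt : ~~ top t by apply: contraL bt; apply: top_not_bot.
have utE : (u, t) \in cw_edges X by case: matchA => /subsetP->.
rewrite (bigD1 u) //= (morse_inc_matched utA ct) mulNr -mulrA.
rewrite mulVr ?(unitA _ utA) // mulr1 addrC (morse_inc_not_top nt ct).
apply/eqP; rewrite subr_eq0; apply/eqP; apply: eq_bigl => s.
rewrite in_setD andbC; congr (_ && _); apply/idP/idP.
  apply: contra => stA; apply/eqP.
  have := @matching_uniq t (s, t) (u, t) stA utA; rewrite /on_edge eqxx !orbT.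
  by case/(_ isT isT).
by apply: contra => /eqP ->.
Qed.

End FromCritical.
End GradientPaths.

(** * The Morse complex of a resolution *)

Section MorseReduction.
Variables (k : fieldType) (n : nat) (X : gcw n) (A : {set edge X}).
Hypothesis orderX : order_preserving X.
Hypothesis matchA : is_matching A.
Hypothesis acyclicA : acyclic A.
Hypothesis homA : homogeneous A.
Hypothesis unitA : forall e, e \in A -> inc e.1 e.2 \is a GRing.unit.
Local Notation R := {mpoly k[n]}.
Local Notation G := (morse_graph A).
Local Notation M := (morse_complex A).
Local Notation chain Y := {ffun acell Y -> R}.

Lemma gr_step s t : G s t -> (gr t <= gr s)%MM.
Proof.
rewrite /morse_graph !inE => /orP[/and3P[_ st _] | /homA /= ->]; last first.
  exact/mnm_lepP.
exact: orderX.
Qed.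

Lemma gr_connect s t : connect G s t -> (gr t <= gr s)%MM.
Proof.
case/connectP=> p; elim: p s => [|x p IHp] s /= => [_ -> //|].
  exact/mnm_lepP.
case/andP=> /gr_step xs xp /(IHp _ xp) tx; exact: lepm_trans xs.
Qed.

Lemma bdry_coef_matched s t : (s, t) \in A ->
  bdry_coef k (Some s) (Some t) * ((inc s t)^-1)%:~R = 1.
Proof.
move=> stA; have stE : (s, t) \in cw_edges X by case: matchA => /subsetP->.
rewrite bdry_coefSS stE (homA stA) /=.
have -> : (gr t - gr t)%MM = 0%MM by apply/mnmP=> i; rewrite mnmBE subnn mnm0E.
rewrite mpolyX0 scaler_int -intrM mulrV //; exact: (unitA stA).
Qed.

(** Triangularity: apart from its partner, a lower end occurs only in boundaries
    of cells of higher rank. *)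
Lemma coef_rank u t s : (u, t) \in A -> s != u ->
  bdry_coef k (Some s) (Some t) != 0 -> (rank A u < rank A t < rank A s)%N.
Proof.
move=> utA su; rewrite bdry_coefSS; case: ifP => [stE _|]; last by rewrite eqxx.
rewrite !(rank_lt acyclicA) // /morse_graph ?utA ?orbT // in_setD stE andbT.
apply/orP; left; apply: contra su => stA; apply/eqP.
have := @matching_uniq _ _ _ matchA t (s, t) (u, t) stA utA.
by rewrite /on_edge eqxx !orbT => /(_ isT isT) [].
Qed.

(** Look at an upper end of maximal rank with nonzero coefficient: the boundary
    coefficient at its partner involves no other cell. *)
Lemma top_inj (f : chain X) :
    (forall c, ~~ oapp (top A) false c -> f c = 0) ->
    (forall c, oapp (bot A) false c -> bdry f c = 0) -> f = 0.
Proof.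
move=> ftop fbot; apply/eqP; apply: contraT => fn0.
have [u0 u0P] : exists u, f (Some u) != 0.
  apply/existsP; apply: contraR fn0 => /existsPn f0.
  apply/eqP/ffunP=> -[u|]; rewrite ffunE; last exact: ftop.
  by apply/eqP; have := f0 u; rewrite negbK.
case: (@arg_maxnP _ u0 (fun u => f (Some u) != 0) (rank A) u0P) => u fu umax.
have /existsP[t utA] : top A u by apply: contraNT fu => nt; rewrite ftop.
have bt : bot A t by apply/existsP; exists u.
have := fbot (Some t) bt; rewrite bdryS (bigD1 u) //= big1 => [|s su].
  rewrite addr0 => /(congr1 (fun x => x * ((inc u t)^-1)%:~R)).
  by rewrite -mulrA bdry_coef_matched // mulr1 mul0r => /eqP; rewrite (negPf fu).
case: (eqVneq (f (Some s)) 0) => [-> | fs]; first by rewrite mul0r.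
apply/eqP; rewrite mulf_eq0 (negPf fs) /=; apply: contraT => /(coef_rank utA su).
case/andP=> ut ts; have /= := umax s fs; rewrite leqNgt.
by rewrite (ltn_trans ut ts).
Qed.

(** Back substitution, by induction on a bound for the ranks of the lower ends
    where f is still to be hit. *)
Lemma bot_onto (f : chain X) :
  exists g : chain X, forall c, oapp (bot A) false c -> bdry g c = f c.
Proof.
suff ind m : forall f : chain X,
    (forall t, bot A t -> (m <= rank A t)%N -> f (Some t) = 0) ->
    exists g : chain X, forall t, bot A t -> bdry g (Some t) = f (Some t).
  have [|g dg] := ind #|cell X|.+1 f.
    by move=> t _; rewrite leqNgt ltnS rank_max.
  by exists g => -[t|] //; apply: dg.
elim: m => [|m IHm] {}f f0.
  by exists 0 => t bt; rewrite f0 // bdryS big1 // => s _; rewrite ffunE mul0r.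
(* The minus sign is compensated below, where g0 is subtracted. *)
pose g0 : chain X := [ffun c =>
  if c is Some u then
    if [pick t | (u, t) \in A] is Some t
    then - (f (Some t) * ((inc u t)^-1)%:~R) else 0
  else 0].
have g0E u t : (u, t) \in A ->
    g0 (Some u) = - (f (Some t) * ((inc u t)^-1)%:~R).
  move=> utA; rewrite ffunE.
  case: pickP => [t' ut'A|/(_ t)]; last by rewrite utA.
  have := @matching_uniq _ _ _ matchA u (u, t) (u, t') utA ut'A.
  by rewrite /on_edge eqxx => /(_ isT isT) [->].
have dg0 t : bot A t -> (m <= rank A t)%N -> bdry g0 (Some t) = - f (Some t).
  case/existsP=> u utA mt; rewrite bdryS (bigD1 u) //= big1 => [|s su].
    rewrite addr0 (g0E _ _ utA) mulNr mulrAC -mulrA.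
    by rewrite bdry_coef_matched // mulr1.
  case: (eqVneq (bdry_coef k (Some s) (Some t)) 0) => [->|].
    by rewrite mulr0.
  case/(coef_rank utA su)/andP=> _ ts.
  case: (pickP (fun t' => (s, t') \in A)) => [t' st'A | nos]; last first.
    by rewrite ffunE; case: pickP => [t'|]; rewrite ?nos // mul0r.
  rewrite (g0E _ _ st'A) f0 ?mul0r ?oppr0 ?mul0r //.
    by apply/existsP; exists s.
  have t's : G t' s by rewrite /morse_graph st'A orbT.
  by rewrite (leq_trans _ (rank_lt acyclicA t's)) // ltnS (leq_trans mt) // ltnW.
have [|g1 dg1] := IHm (f + bdry g0).
  by move=> t bt mt; rewrite ffunE dg0 // subrr.
by exists (g1 - g0) => t bt; rewrite bdryB ffunE dg1 // !ffunE addrK.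
Qed.

Definition crit_incl (c : acell M) : acell X := omap val c.

Lemma acell_cover c : [\/ exists c', c = crit_incl c',
  oapp (top A) false c | oapp (bot A) false c].
Proof.
case: c => [c|]; last by constructor 1; exists None.
case: (boolP (critical A c)) => [crit|].
  by constructor 1; exists (Some (exist _ c crit)).
by rewrite criticalE negb_and !negbK => /orP[]; [constructor 2 | constructor 3].
Qed.

Definition lift_coef (c x : cell X) : R :=
  if cdim c == cdim x
  then (morse_inc A c x)%:~R *: 'X_[(gr c - gr x)%MM] else 0.

(** The extension of a critical cell c consists of the cells of the dimension of
    c reached by gradient paths; apart from c these are upper ends. *)
Definition morse_lift (f : chain M) : chain X :=
  [ffun x => if x is Some x
             then \sum_(c : cell M) f (Some c) * lift_coef (val c) x
             else f None].

Lemma lift_incl f c : morse_lift f (crit_incl c) = f c.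
Proof.
case: c => [[x critx]|]; rewrite ffunE //=.
rewrite (bigD1 (exist _ x critx)) //= big1 => [|[c critc] cx].
  rewrite /lift_coef eqxx morse_inc_critical // eqxx.
  have -> : (gr x - gr x)%MM = 0%MM by apply/mnmP=> i; rewrite mnmBE subnn mnm0E.
  by rewrite mpolyX0 scale1r mulr1 addr0.
rewrite /lift_coef /=; case: eqP => [cdx|]; last by rewrite mulr0.
rewrite morse_inc_critical //; have /negPf -> : c != x by apply: contra cx.
by rewrite scale0r mulr0.
Qed.

Lemma lift_bot f c : oapp (bot A) false c -> morse_lift f c = 0.
Proof.
case: c => [x|] //= bx; rewrite ffunE big1 // => -[c critc] _.
rewrite /lift_coef /=; case: eqP => [cdx|]; last by rewrite mulr0.
by rewrite morse_inc_bot // scale0r mulr0.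
Qed.

(** The monomials multiply as they should because the grading decreases along
    gradient paths; when there is no path the coefficient vanishes. *)
Lemma lift_coef_step (c s t : cell X) :
  lift_coef c s * bdry_coef k (Some s) (Some t) =
  if (cdim c == (cdim t).+1) && ((s, t) \in cw_edges X)
  then (morse_inc A c s * inc s t)%:~R *: 'X_[(gr c - gr t)%MM] else 0.
Proof.
rewrite bdry_coefSS /lift_coef; case: (boolP (_ \in _)) => [stE|_]; last first.
  by rewrite mulr0 andbF.
have := stE; rewrite inE /= => /andP[fst /eqP st]; rewrite st andbT.
case: eqP => // _; last by rewrite mul0r.
rewrite -scalerAl -scalerAr scalerA -intrM.
case: (boolP (connect G c s)) => [cs | /(morse_inc_connect) ->]; last first.
  by rewrite mul0r !scale0r.
congr (_ *: _); rewrite -mpolyXD; congr 'X_[_].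
have /mnm_lepP gcs := gr_connect cs; have /mnm_lepP gst := orderX fst.
apply/mnmP=> i; rewrite mnmDE !mnmBE addnBA ?gst // subnK //; exact: gcs.
Qed.

Lemma bdry_lift f t : bdry (morse_lift f) (Some t) =
  \sum_(c : cell M) f (Some c) *
    (if cdim (val c) == (cdim t).+1 then
      (\sum_(s | (s, t) \in cw_edges X) morse_inc A (val c) s * inc s t)%:~R
        *: 'X_[(gr (val c) - gr t)%MM] else 0).
Proof.
rewrite bdryS; under eq_bigr do rewrite ffunE big_distrl /=.
rewrite exchange_big; apply: eq_bigr => -[c critc] _ /=.
under eq_bigr do rewrite -mulrA; rewrite -big_distrr /=; congr (_ * _).
under eq_bigr do rewrite lift_coef_step //.
case: ifP => _ /=; last by rewrite big1.
by rewrite -big_mkcond /= rmorph_sum /= scaler_suml.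
Qed.

Lemma bdry_lift_incl f c : bdry (morse_lift f) (crit_incl c) = bdry f c.
Proof.
case: c => [[t critt]|] /=.
  rewrite bdry_lift [RHS]bdryS; apply: eq_bigr => -[c critc] _ /=; congr (_ * _).
  rewrite bdry_coefSS inE /= andbC; case: eqP => //= ct.
  rewrite lift_boundary_critical //.
  by case: ifP => // /negbT /morse_inc_connect ->; rewrite scale0r.
rewrite !bdryN (bigID (critical A)) /= [X in _ + X]big1 => [|s].
  pose F s := morse_lift f (Some s) * bdry_coef k (Some s) None.
  rewrite addr0 -(sum_sig _ F) /F.
  apply: eq_bigr => c _; rewrite !bdry_coefSN; congr (_ * _).
  exact: (lift_incl f (Some c)).
rewrite (criticalE) negb_and !negbK bdry_coefSN => /orP[ts|bs].
  case/existsP: ts => t stA; have [_ ->] := matched_edge matchA stA.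
  by rewrite mulr0.
by rewrite lift_bot ?mul0r.
Qed.

Lemma bdry_lift_bot f c : oapp (bot A) false c -> bdry (morse_lift f) c = 0.
Proof.
case: c => [t|] //= bt; rewrite bdry_lift big1 // => -[c critc] _ /=.
case: eqP => ct; last by rewrite mulr0.
by rewrite lift_boundary_bot // scale0r mulr0.
Qed.

Lemma morse_order_preserving : order_preserving M.
Proof. by move=> s t; apply: gr_connect. Qed.

Theorem morse_augmented_resolution (I : R -> Prop) :
  augmented_resolution X I -> augmented_resolution M I.
Proof.
case=> dd exX imX.
have cyc := reduced_cycle dd acell_cover top_inj bdry_lift_incl bdry_lift_bot.
have bnd := reduced_boundary (@bdryB k n X) dd acell_cover top_inj bot_onto
  lift_incl lift_bot bdry_lift_incl bdry_lift_bot.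
split=> [f | f f0 df | p].
- by apply: (reduced_dd (@bdryB k n X) dd acell_cover top_inj bot_onto
  lift_incl lift_bot bdry_lift_incl bdry_lift_bot).
- apply/bnd/exX; first by rewrite ffunE.
  exact/cyc.
have liftp : morse_lift (at_empty M p) = at_empty X p.
  apply/ffunP=> -[x|]; rewrite !ffunE // big1 // => c _.
  by rewrite ffunE mul0r.
by rewrite imX -liftp; apply: iff_sym.
Qed.

End MorseReduction.

(** * The full simplex *)

(** The summands are paired off rather than shown to be equal to their own
    opposite, since V may have 2-torsion. *)
Lemma sum_alternating (V : zmodType) r (F : 'I_r -> 'I_r -> V) :
  (forall i, F i i = 0) -> (forall i j, F i j = - F j i) ->
  \sum_i \sum_j F i j = 0.
Proof.
move=> F0 FN; have split i : \sum_j F i j =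
    \sum_(j < r | (i < j)%N) F i j + \sum_(j < r | (j < i)%N) F i j.
  rewrite (bigD1 i) //= F0 add0r (bigID (fun j : 'I_r => (i < j)%N)) /=.
  congr (_ + _); apply: eq_bigl => j; rewrite -val_eqE /= neq_ltn;
    by case: ltngtP.
under eq_bigr do rewrite split; rewrite big_split /=.
rewrite [X in _ + X](exchange_big_dep xpredT) //= -big_split big1 //= => i _.
by rewrite -big_split big1 //= => j _; rewrite FN addNr.
Qed.

(** The simplicial chains have coefficients in an arbitrary abelian group: R is
    needed for the boundary of Taylor chains, the field for single
    coefficients. *)
Section Simplex.
Variables (r : nat) (V : zmodType).
Implicit Types (i j : 'I_r) (s t : {set 'I_r}) (c : {set 'I_r} -> V).

(** The sign of the face of s opposite to j; it does not depend on whether j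
    lies in s. *)
Definition sgn j s : int := (-1) ^+ #|[set i in s | (i < j)%N]|.

Lemma sgn_sqr j s : sgn j s * sgn j s = 1.
Proof. by rewrite /sgn -exprD addnn -mul2n exprM sqrrN expr1n. Qed.

Lemma sgnU1 i j s : j \notin s -> sgn i (j |: s) = (-1) ^+ (j < i)%N * sgn i s.
Proof.
move=> js; rewrite /sgn -exprD; congr (_ ^+ _).
have -> : [set x in j |: s | (x < i)%N] =
    [set x in [set j] | (x < i)%N] :|: [set x in s | (x < i)%N].
  by apply/setP=> x; rewrite !inE andb_orl.
rewrite cardsU disjoint_setI0 ?cards0 ?subn0.
  congr (_ + _)%N; case: ltnP => ji.
    transitivity #|[set j]|; last by rewrite cards1.
    by apply: eq_card => x; rewrite !inE; case: eqP => // ->.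
  apply: eq_card0 => x; rewrite !inE; case: eqP => // ->.
  by rewrite ltnNge ji.
rewrite -setI_eq0; apply/eqP/setP=> x; rewrite !inE; case: eqP => //= ->.
by rewrite (negPf js) !andbF.
Qed.

Lemma sgnU1_id i s : sgn i (i |: s) = sgn i s.
Proof.
rewrite /sgn; congr (_ ^+ _); apply: eq_card => x; rewrite !inE.
by case: eqP => //= ->; rewrite ltnn andbF.
Qed.

Lemma sign_lt i j : i != j -> (-1) ^+ (i < j)%N = - (-1) ^+ (j < i)%N :> int.
Proof.
case: (ltngtP i j) => [_ _|_ _|/val_inj ->]; last by rewrite eqxx.
- by rewrite expr0 expr1.
- by rewrite expr0 expr1 opprK.
Qed.

Lemma sgn_swap i j s : i != j -> i \notin s -> j \notin s ->
  sgn i (j |: s) * sgn j s = - (sgn j (i |: s) * sgn i s).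
Proof.
move=> ij si sj; rewrite !sgnU1 // (sign_lt ij) -!mulrA.
by rewrite [sgn j s * _]mulrC mulNr opprK.
Qed.

Lemma sgn_cross i j s : i != j -> i \notin s -> j \notin s ->
  sgn i (j |: s) * sgn j (i |: s) = - (sgn i s * sgn j s).
Proof.
move=> ij si sj; rewrite !sgnU1 // (sign_lt ij) mulrACA mulrN -expr2 sqrr_sign.
by rewrite mulN1r.
Qed.

Lemma simplex_inc_U1 j t : j \notin t -> simplex_inc (j |: t) t = sgn j t.
Proof.
move=> jt; rewrite /simplex_inc (big_pred1 j) => [|i]; first exact: sgnU1_id.
rewrite !inE; case: (eqVneq i j) => [->|ij] /=; first by rewrite setU1K ?eqxx.
apply/negbTE/negP=> /andP[it /eqP teq].
by move: it; rewrite teq !inE eqxx.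
Qed.

Lemma simplex_inc_eq0 s t :
  (forall j, j \notin t -> s != j |: t) -> simplex_inc s t = 0.
Proof.
move=> no; rewrite /simplex_inc big1 // => i /andP[si /eqP ti].
have := no i; rewrite ti !inE eqxx /= => /(_ isT).
by rewrite setD1K ?eqxx.
Qed.

Definition sbdry c t : V := \sum_s c s *~ simplex_inc s t.

Lemma sbdryE c t : sbdry c t = \sum_(j | j \notin t) c (j |: t) *~ sgn j t.
Proof.
rewrite /sbdry; under eq_bigr do rewrite /simplex_inc mulrz_sumr.
rewrite (exchange_big_dep xpredT) //= [RHS]big_mkcond; apply: eq_bigr => j _ /=.
case: (boolP (j \in t)) => [jt | jt].
  rewrite big_pred0 // => s; apply: contraTF jt => /andP[_ /eqP ->].
  by rewrite !inE eqxx.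
rewrite (big_pred1 (j |: t)) => [|s]; first by rewrite -sgnU1_id.
apply/andP/eqP => [[js /eqP ->] | ->]; first by rewrite setD1K.
by rewrite setU11 setU1K.
Qed.

Lemma sbdry_sbdry c t : sbdry (sbdry c) t = 0.
Proof.
pose F j i := if [&& j \notin t, i \notin t & i != j]
  then c (i |: (j |: t)) *~ (sgn i (j |: t) * sgn j t) else 0.
rewrite -[RHS](@sum_alternating _ _ F) => [|i|i j]; last 2 first.
- by rewrite /F eqxx !andbF.
- rewrite /F [j == i]eq_sym andbCA.
  case: ifP => [/and3P[jt it ij]|]; last by rewrite oppr0.
  by rewrite setUCA sgn_swap 1?eq_sym // mulrNz.
rewrite sbdryE big_mkcond; apply: eq_bigr => j _; rewrite /F.
case: ifP => /= [jt|_]; last by rewrite big1.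
rewrite sbdryE big_mkcond mulrz_suml; apply: eq_bigr => i _.
rewrite !inE negb_or andbC; case: ifP => //=; rewrite ?mul0rz // => _.
by rewrite mulrzA.
Qed.

(** Exterior multiplication by the vertex i. *)
Definition cone i c s : V := if i \in s then c (s :\ i) *~ sgn i s else 0.

Lemma cone_homotopy i c t : sbdry (cone i c) t + cone i (sbdry c) t = c t.
Proof.
rewrite {2}/cone; case: ifP => it; last first.
  rewrite addr0 sbdryE (bigD1 i) ?it //= big1 => [|j /andP[_ ji]].
    by rewrite addr0 /cone setU11 setU1K ?it // sgnU1_id -mulrzA sgn_sqr.
  by rewrite /cone !inE it eq_sym (negPf ji) mul0rz.
pose u := t :\ i; have iu : i \notin u by rewrite !inE eqxx.
have tE : t = i |: u by rewrite setD1K.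
rewrite -/u tE [X in _ + X *~ _]sbdryE (bigD1 i) //= mulrzDl -mulrzA.
rewrite sgnU1_id sgn_sqr.
rewrite addrCA -[RHS]addr0; congr (_ + _).
rewrite sbdryE mulrz_suml.
have eqP0 j : (j \notin i |: u) = (j \notin u) && (j != i).
  by rewrite !inE negb_or andbC.
rewrite (eq_bigl _ _ eqP0) -big_split big1 //= => j /andP[ju ji].
rewrite /cone setUCA setU11 setU1K; last by rewrite in_setU1 negb_or eq_sym ji.
rewrite -!mulrzA sgnU1_id -mulrzDr.
by rewrite sgn_cross 1?eq_sym // [sgn j u * _]mulrC addNr.
Qed.

End Simplex.

(** * Exactness of the Taylor complex *)

Section Monomials.
Variables (k : fieldType) (n : nat).
Implicit Types (p : {mpoly k[n]}) (a b : 'X_{1..n}).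

Lemma mcoeffMX_le p a b : (p * 'X_[a])@_b != 0 -> (a <= b)%MM.
Proof.
rewrite -mcoeff_msupp (perm_mem (msuppMX _ _)) => /mapP[b' _ ->].
exact: lem_addr.
Qed.

Lemma mulIX a : injective (fun p => p * 'X_[a]).
Proof.
by move=> p q pq; apply/mpolyP=> b; rewrite -(mcoeffMX p a) -(mcoeffMX q a) pq.
Qed.

Definition mdivX p a : {mpoly k[n]} :=
  \sum_(b <- msupp p) p@_b *: 'X_[(b - a)%MM].

Lemma mdivXK p a :
  (forall b, p@_b != 0 -> (a <= b)%MM) -> mdivX p a * 'X_[a] = p.
Proof.
move=> ap; rewrite [RHS]mpolyE big_distrl !big_seq /=; apply: eq_bigr => b.
by rewrite mcoeff_msupp => /ap ab; rewrite -scalerAl -mpolyXD submK.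
Qed.

Definition mfilter (P : pred 'X_{1..n}) p : {mpoly k[n]} :=
  \sum_(b <- msupp p | P b) p@_b *: 'X_[b].

Lemma mcoeff_filter P p b : (mfilter P p)@_b = if P b then p@_b else 0.
Proof.
rewrite raddf_sum /=; under eq_bigr do rewrite mcoeffZ mcoeffX.
case: (boolP (b \in msupp p)) => [bp | bp].
  rewrite big_mkcond (bigD1_seq b) //= eqxx mulr1.
  rewrite big1_seq ?addr0 // => a /andP[ab _].
  by rewrite (negPf ab) mulr0 if_same.
rewrite (memN_msupp_eq0 bp) if_same big1_seq // => a /andP[_ ap].
by case: eqP ap bp => [-> ->|]; rewrite ?mulr0.
Qed.

End Monomials.

Section Taylor.
Variables (k : fieldType) (n r : nat) (m : r.-tuple 'X_{1..n}).
Local Notation R := {mpoly k[n]}.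
Local Notation T := (taylor m).
Local Notation chain := {ffun acell T -> R}.

Lemma lcm_label_le (s : {set 'I_r}) a :
  (lcm_label m s <= a)%MM = [forall i in s, (tnth m i <= a)%MM].
Proof.
rewrite /lcm_label -big_andE; elim/big_rec2: _ => [|i b x _ <-].
  by apply/mnm_lepP=> i; rewrite mnm0E.
by rewrite lem_mlcm.
Qed.

Lemma lcm_labelS (s t : {set 'I_r}) :
  t \subset s -> (lcm_label m t <= lcm_label m s)%MM.
Proof.
move=> /subsetP ts; rewrite lcm_label_le; apply/forall_inP=> i /ts si.
have : (lcm_label m s <= lcm_label m s)%MM by apply/mnm_lepP.
by rewrite lcm_label_le => /forall_inP; apply.
Qed.

Lemma lcm_label1 i : lcm_label m [set i] = tnth m i.
Proof.
have leP a : (lcm_label m [set i] <= a)%MM = (tnth m i <= a)%MM.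
  rewrite lcm_label_le; apply/forall_inP/idP => [|ia j /set1P -> //].
  by apply; apply: set11.
have /mnm_lepP le1 : (lcm_label m [set i] <= tnth m i)%MM.
  by rewrite leP; apply/mnm_lepP.
have /mnm_lepP le2 : (tnth m i <= lcm_label m [set i])%MM.
  by rewrite -leP; apply/mnm_lepP.
by apply/mnmP=> j; apply/eqP; rewrite eqn_leq le1 le2.
Qed.

Lemma taylor_order_preserving : order_preserving T.
Proof. by move=> s t; apply: lcm_labelS. Qed.

Definition vset (c : acell T) : {set 'I_r} :=
  if c is Some s then val s else set0.

Definition of_vset (s : {set 'I_r}) : acell T := insub s.

Lemma of_vsetK : cancel of_vset vset.
Proof.
move=> s; rewrite /of_vset; case: insubP => [u _ <- //|].
by rewrite negbK => /eqP ->.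
Qed.

Lemma vsetK : cancel vset of_vset.
Proof.
case=> [s|]; first by rewrite /of_vset valK.
by rewrite /of_vset insubN //= eqxx.
Qed.

Lemma agr_vset c : agr c = lcm_label m (vset c).
Proof. by case: c => [s|] //=; rewrite /lcm_label big_set0. Qed.

(** Multiplied by the label of the target, a Taylor coefficient becomes the
    simplicial incidence times the label of the source; in particular no
    quotient of labels is left. *)
Lemma bdry_coef_taylor (c c' : acell T) :
  bdry_coef k c c' * 'X_[agr c'] = 'X_[agr c] *~ simplex_inc (vset c) (vset c').
Proof.
have key (s t : {set 'I_r}) :
    ~~ ((t \subset s) && (#|s| == #|t|.+1)) -> simplex_inc s t = 0.
  move=> no; apply: simplex_inc_eq0 => j jt; apply: contra no => /eqP ->.
  by rewrite subsetU1 cardsU1 jt add1n eqxx.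
have pos (s : cell T) : #|val s| = #|val s|.-1.+1.
  by rewrite prednK // card_gt0; apply: (valP s).
rewrite /bdry_coef; case: c c' => [s|] [t|] /=.
- rewrite -!pos; case: ifP => [/andP[ts _]|/negbT /key ->]; last by rewrite mul0r.
  by rewrite -scalerAl -mpolyXD submK ?scaler_int //; apply: lcm_labelS.
- rewrite -pos. rewrite subm0 mpolyX0 mulr1; case: ifP => [|no]; last first.
    by rewrite key ?mulr0z // sub0set cards0 no.
  case/cards1P=> j sj; rewrite scale1r sj -[[set j]](setU0 [set j]).
  rewrite simplex_inc_U1 ?inE //.
  rewrite /sgn [X in _ ^+ X](_ : _ = 0%N) ?expr0 //.
  by apply: eq_card0 => x; rewrite !inE.
- rewrite mul0r simplex_inc_eq0 ?mulr0z // => j jt.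
  by rewrite eq_sym -card_gt0 cardsU1 jt.
- rewrite mul0r simplex_inc_eq0 ?mulr0z // => j jt.
  by rewrite eq_sym -card_gt0 cardsU1 jt.
Qed.

Definition homogenize (f : chain) (s : {set 'I_r}) : R :=
  f (of_vset s) * 'X_[lcm_label m s].

Lemma homogenize_inj f g : homogenize f =1 homogenize g -> f = g.
Proof.
move=> fg; apply/ffunP=> c; rewrite -(vsetK c).
exact: mulIX (fg (vset c)).
Qed.

Lemma homogenize_bdry f s : homogenize (bdry f) s = sbdry (homogenize f) s.
Proof.
rewrite /homogenize -[in 'X_[_]](of_vsetK s) -agr_vset ffunE big_distrl /sbdry /=.
rewrite (reindex of_vset) /=; last first.
  by exists vset => c _; [apply: of_vsetK | apply: vsetK].
apply: eq_bigr => u _; rewrite -mulrA bdry_coef_taylor !of_vsetK agr_vset of_vsetK.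
by rewrite mulrzAr.
Qed.

Lemma taylor_bdry_bdry (f : chain) : bdry (bdry f) = 0.
Proof.
apply: homogenize_inj => s; rewrite homogenize_bdry.
rewrite [RHS]/homogenize ffunE mul0r -(sbdry_sbdry (homogenize f) s) /sbdry.
by apply: eq_bigr => u _; rewrite homogenize_bdry.
Qed.

(** A vertex that spans a cone containing all faces whose label divides x^a. *)
Definition apex (a : 'X_{1..n}) : option 'I_r := [pick i | (tnth m i <= a)%MM].

Lemma mcoeff_sbdry (c : {set 'I_r} -> R) s a :
  (sbdry c s)@_a = sbdry (fun u => (c u)@_a) s.
Proof. by rewrite /sbdry raddf_sum; apply: eq_bigr => u _; rewrite raddfMz. Qed.

(** The preimage is assembled from the cones over [apex a], one for each
    monomial x^a; its coefficient at s is divisible by the label of s because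
    x^a is divisible by the label of the face that is coned and by the label of
    the vertex [apex a]. *)
Lemma taylor_exact (f : chain) :
  f None = 0 -> bdry f = 0 -> exists g, bdry g = f.
Proof.
move=> f0 df0.
pose h (s : {set 'I_r}) : R := \sum_(i in s)
  mfilter (fun a => apex a == Some i) (homogenize f (s :\ i)) *~ sgn i s.
have hE s a : (h s)@_a =
    if apex a is Some i then cone i (fun u => (homogenize f u)@_a) s else 0.
  rewrite raddf_sum; under eq_bigr do rewrite raddfMz /= mcoeff_filter.
  case: (apex a) => [i|]; last by rewrite big1 // => i _; rewrite mul0rz.
  rewrite /cone big_mkcond (bigD1 i) //= eqxx big1 ?addr0 // => j ji.
  have /negPf -> : Some i != Some j by apply: contra ji => /eqP[->].
  by rewrite mul0rz if_same.
have hle s a : (h s)@_a != 0 -> (lcm_label m s <= a)%MM.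
  rewrite hE /apex; case: pickP => [i ia|]; last by rewrite eqxx.
  rewrite /cone; case: ifP => si; last by rewrite eqxx.
  case: (eqVneq (homogenize f (s :\ i))@_a 0) => [->|/mcoeffMX_le].
    by rewrite mul0rz eqxx.
  rewrite !lcm_label_le => /forall_inP le _; apply/forall_inP=> j sj.
  by case: (eqVneq j i) => [-> //|ji]; apply: le; rewrite !inE ji.
pose g : chain := [ffun c => mdivX (h (vset c)) (lcm_label m (vset c))].
have gh s : homogenize g s = h s.
  by rewrite /homogenize ffunE of_vsetK mdivXK //; apply: hle.
exists g; apply: homogenize_inj => s; rewrite homogenize_bdry; apply/mpolyP=> a.
have -> : sbdry (homogenize g) s = sbdry h s by apply: eq_bigr => u _; rewrite gh.
rewrite mcoeff_sbdry; under [LHS]eq_bigr do rewrite hE.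
rewrite /apex; case: pickP => [i _ | no].
  rewrite -[RHS](cone_homotopy i (fun u => (homogenize f u)@_a) s).
  rewrite -[LHS]addr0; congr (_ + _).
  rewrite /cone; case: ifP => // _; rewrite -mcoeff_sbdry -homogenize_bdry df0.
  by rewrite /homogenize ffunE mul0r mcoeff0 mul0rz.
rewrite big1 => [|u _]; last by rewrite mul0rz.
apply/esym/eqP; apply: contraT; case: (eqVneq s set0) => [->|/set0Pn[j js]].
  by rewrite /homogenize /of_vset insubN ?eqxx // f0 mul0r mcoeff0 eqxx.
by move/mcoeffMX_le; rewrite lcm_label_le => /forall_inP/(_ _ js); rewrite no.
Qed.

Lemma taylor_image (p : R) :
  monomial_ideal m p <-> exists g, bdry g = at_empty T p.
Proof.
have h0 s : homogenize (at_empty T p) s = if s == set0 then p else 0.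
  rewrite /homogenize ffunE; case: eqP => [->|/eqP s0].
    by rewrite /of_vset insubN ?eqxx // /lcm_label big_set0 mpolyX0 mulr1.
  by rewrite /of_vset insubT mul0r.
have sbdry0 g : sbdry (homogenize g) set0 =
    \sum_i g (of_vset [set i]) * 'X_[tnth m i].
  rewrite sbdryE; apply: eq_big => [i|i _]; first by rewrite inE.
  rewrite setU0 /homogenize lcm_label1 /sgn [X in _ ^+ X](_ : _ = 0%N) ?expr0 //.
  by apply: eq_card0 => x; rewrite !inE.
split=> [[c pE] | [g dg]]; last first.
  exists (fun i => g (of_vset [set i])).
  by rewrite -sbdry0 -homogenize_bdry dg h0 eqxx.
pose g : chain := [ffun x => \sum_(i | vset x == [set i]) c i].
exists g; apply: homogenize_inj => s; rewrite homogenize_bdry h0.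
case: eqP => [->|/eqP s0].
  rewrite sbdry0 pE; apply: eq_bigr => i _; rewrite ffunE of_vsetK.
  by rewrite (big_pred1 i) // => j; rewrite (inj_eq set1_inj) eq_sym.
rewrite sbdryE big1 // => j js; rewrite /homogenize ffunE of_vsetK.
rewrite big_pred0 ?mul0r ?mul0rz // => i.
apply: contraNF s0 => /eqP/(congr1 (fun u : {set _} => #|u|)).
by rewrite cardsU1 js cards1 => -[/eqP]; rewrite cards_eq0.
Qed.

Theorem taylor_augmented_resolution :
  augmented_resolution T (monomial_ideal (k := k) m).
Proof.
split; [exact: taylor_bdry_bdry | exact: taylor_exact | exact: taylor_image].
Qed.

End Taylor.

(** * The pruning algorithm *)

Lemma path_exit (T : Type) (e : rel T) (Q : pred T) x p :
  path e x p -> Q x -> ~~ Q (last x p) -> exists y z, [/\ e y z, Q y & ~~ Q z].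
Proof.
elim: p x => [|y p IHp] x /= => [_ -> //|/andP[xy yp] Qx nQ].
by case: (boolP (Q y)) => Qy; [apply: IHp yp Qy nQ | exists x, y].
Qed.

Section Pruning.
Variables (n r : nat) (m : r.-tuple 'X_{1..n}).
Local Notation T := (taylor m).

Definition in_direction (j : 'I_r) (e : edge T) : bool :=
  (j \notin val e.2) && (val e.1 == j |: val e.2).

Definition touch (e e' : edge T) : bool := on_edge e.1 e' || on_edge e.2 e'.

(** The state reached when the directions below i have been treated.  The field
    [pruned_greedy] records why an edge was not pruned when its turn came: one
    of its ends had been removed together with an edge of smaller direction. *)
Record pruning_state (i : nat) (st : {set edge T} * {set edge T}) : Prop :=
  PruningState {
    surviving :
      st.1 = [set e in cw_edges T | [forall e' in st.2, ~~ touch e e']];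
    pruned_cw : st.2 \subset cw_edges T;
    pruned_gr : homogeneous st.2;
    pruned_direction : forall e, e \in st.2 ->
      exists2 j : 'I_r, (j < i)%N & in_direction j e;
    pruned_disjoint : forall c e e', e \in st.2 -> e' \in st.2 ->
      on_edge c e -> on_edge c e' -> e = e';
    pruned_greedy : forall (j : 'I_r) e, (j < i)%N -> e \in cw_edges T ->
      in_direction j e -> gr e.1 = gr e.2 -> e \notin st.2 ->
      exists e' (j' : 'I_r),
        [/\ e' \in st.2, touch e e', (j' < j)%N & in_direction j' e']
  }.

Lemma in_direction_disjoint j c e e' : in_direction j e -> in_direction j e' ->
  on_edge c e -> on_edge c e' -> e = e'.
Proof.
case: e e' => [s t] [s' t'] /andP[/= jt /eqP sE] /andP[/= jt' /eqP sE'].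
rewrite /on_edge /= => /orP[]/eqP-> /orP[]/eqP eqc.
- have st : val t = val t'.
    by rewrite -[LHS](setU1K jt) -[RHS](setU1K jt') -sE -sE' eqc.
  by rewrite eqc (val_inj st).
- by move: jt'; rewrite -eqc sE setU11.
- by move: jt; rewrite eqc sE' setU11.
- have st : val s = val s' by rewrite [LHS]sE [RHS]sE' eqc.
  by rewrite eqc (val_inj st).
Qed.

Lemma prune_step_state (j : 'I_r) st :
  pruning_state j st -> pruning_state j.+1 (prune_step st j).
Proof.
case: st => S P [/= SE Pcw Pgr Pdir Pdis Pgreedy].
have newP e : e \in prunable S j ->
    [/\ e \in S, in_direction j e & gr e.1 = gr e.2].
  by rewrite inE => /and4P[? ? ? /eqP]; split=> //; apply/andP.
have S_old e e' c : e \in S -> e' \in P -> on_edge c e -> on_edge c e' -> False.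
  rewrite SE inE => /andP[_ /forall_inP/(_ e')] no /no.
  by rewrite /touch negb_or {1 2}/on_edge => /andP[n1 n2] /orP[]/eqP ce ce';
     move: n1 n2; rewrite -ce -/(on_edge c e') ce'.
split=> /=.
- apply/setP=> e; rewrite SE !inE -andbA; congr (_ && _).
  apply/andP/forall_inP => [[/forall_inP old /forall_inP new] e'|all].
    by rewrite inE => /orP[/old // | /new]; rewrite /touch negb_or.
  split; apply/forall_inP=> e' e'P; first by apply: all; rewrite inE e'P.
  by rewrite -negb_or; apply: all; rewrite inE e'P orbT.
- rewrite subUset Pcw /=; apply/subsetP=> e /newP[].
  by rewrite SE inE => /andP[].
- by move=> e; rewrite inE => /orP[/Pgr // | /newP[]].
- move=> e; rewrite inE => /orP[/Pdir[i ij ei] | /newP[_ ej _]].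
    by exists i; rewrite // ltnS ltnW.
  by exists j.
- move=> c e e'; rewrite !in_setU => /orP[eP|eN] /orP[e'P|e'N] ce ce'.
  + exact: Pdis ce ce'.
  + by have [e'S _ _] := newP _ e'N; case: (S_old _ _ _ e'S eP ce' ce).
  + by have [eS _ _] := newP _ eN; case: (S_old _ _ _ eS e'P ce ce').
  + have [[_ ej _] [_ e'j _]] := (newP _ eN, newP _ e'N).
    exact: in_direction_disjoint ej e'j ce ce'.
- move=> i e; rewrite ltnS leq_eqVlt in_setU negb_or.
  move=> /orP[/eqP/val_inj->|ij] ecw ei egr /andP[eP eN].
    have : e \notin S.
      apply: contra eN => eS; rewrite inE eS.
      by case/andP: ei => -> ->; apply/eqP.
    rewrite SE inE ecw negb_forall_in => /exists_inP[e' e'P].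
    rewrite negbK => ee'.
    by have [j' j'j dj'] := Pdir _ e'P; exists e', j'; rewrite inE e'P.
  have [e' [j' [e'P ee' j'i dj']]] := Pgreedy i e ij ecw ei egr eP.
  by exists e', j'; rewrite inE e'P.
Qed.

Lemma pruned_edges_state : exists S, pruning_state r (S, pruned_edges m).
Proof.
suff run i : (i <= r)%N -> pruning_state i
    (foldl (@prune_step n r m) (cw_edges T, set0) (take i (enum 'I_r))).
  have := run r (leqnn r); rewrite take_oversize ?size_enum_ord //.
  by rewrite /pruned_edges; case: (foldl _ _ _) => S P; exists S.
elim: i => [_|i IHi ir].
  rewrite take0; split=> //=; last 3 first.
  - by move=> e; rewrite inE.
  - by move=> e; rewrite inE.
  - by move=> c e e'; rewrite inE.
  - apply/setP=> e; rewrite inE; case: (_ \in _) => //=.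
    by apply/esym/forall_inP=> e'; rewrite inE.
  - exact: sub0set.
pose j := Ordinal ir.
rewrite (take_nth j) ?size_enum_ord // -[X in nth _ _ X]/(val j) nth_ord_enum.
by rewrite foldl_rcons; exact: (@prune_step_state j _ (IHi (ltnW ir))).
Qed.

Local Notation A := (pruned_edges m).

Lemma pruned_matching : is_matching A.
Proof.
have [S [_ cw _ _ dis _]] := pruned_edges_state; split=> // c.
apply/card_le1_eqP=> e e'; rewrite !inE => /andP[eA ce] /andP[e'A ce'].
exact: (dis c).
Qed.

Lemma pruned_homogeneous : homogeneous A.
Proof. by have [S []] := pruned_edges_state. Qed.

Lemma pruned_unit e : e \in A -> inc e.1 e.2 \is a GRing.unit.
Proof.
have [S [_ _ _ dir _ _]] := pruned_edges_state.
case/dir=> j _ /andP[je /eqP /= ->]; rewrite simplex_inc_U1 //.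
by rewrite unitrX // unitrN1.
Qed.

(** A cycle keeps the functions [gr] and [depth] constant.  The latter forces
    downward and reversed edges to alternate: a downward edge leaves a cell that
    is no lower end and reaches a lower end. *)
Lemma pruned_acyclic : acyclic A.
Proof.
have [S [_ /= cwA homA dirA disA greedyA]] := pruned_edges_state.
have matchA := pruned_matching.
have gr_le x y := @gr_connect _ _ _ (@taylor_order_preserving n r m) homA x y.
move=> p cp; case pE: p => [//|x0 p']; exfalso.
have x0p : x0 \in p by rewrite pE inE eqxx.
have gr_p x y : x \in p -> y \in p -> gr x = gr y.
  move=> xp yp; apply/mnmP=> i; apply/eqP; rewrite eqn_leq.
  have /mnm_lepP -> := gr_le _ _ (connect_cycle cp xp yp).
  by have /mnm_lepP -> := gr_le _ _ (connect_cycle cp yp xp).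
have depth_p x y : x \in p -> y \in p -> depth A x = depth A y.
  move=> xp yp; apply/eqP; rewrite eqn_leq.
  by rewrite !(connect_depth matchA (connect_cycle cp _ _)).
have down x y : x \in p -> y \in p -> (x, y) \in cw_edges T ->
    bot A y && ~~ bot A x.
  move=> xp yp; rewrite inE => /andP[_ /eqP xy]; have := depth_p x y xp yp.
  rewrite /depth; move: xy => /= -> /eqP; rewrite addSnnS eqn_add2l.
  by case: (bot A x) (bot A y) => -[].
have inA x : x \in p ->
    exists e, [/\ e \in A, on_edge x e, e.1 \in p & e.2 \in p].
  move=> xp; case: (boolP (bot A x)) => bx.
    have yp : next p x \in p by rewrite mem_next.
    case/orP: (next_cycle cp xp) => [|yx]; last first.
      by exists (next p x, x); rewrite /on_edge eqxx orbT.
    by rewrite inE => /andP[_ /(down _ _ xp yp)]; rewrite bx andbF.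
  have yp : prev p x \in p by rewrite mem_prev.
  case/orP: (prev_cycle cp xp) => [|xy]; last first.
    by exists (x, prev p x); rewrite /on_edge eqxx.
  by rewrite inE => /andP[_ /(down _ _ yp xp)]; rewrite (negPf bx).
(* The directions of the pruned edges that lie on the cycle. *)
pose D := [pred j |
  [exists e in A, [&& in_direction j e, e.1 \in p & e.2 \in p]]].
have [e0 [e0A _ e01 e02]] := inA x0 x0p.
have [j0 _ e0j0] := dirA _ e0A.
have Dj0 : D j0 by apply/exists_inP; exists e0; rewrite // e0j0 e01.
case: (arg_minnP (val : 'I_r -> nat) Dj0) => j.
move=> /exists_inP[e eA /and3P[ej e1 e2]] jmin.
pose G' := [rel x y | [&& morse_graph A x y, x \in p & y \in p]].
have cp' : cycle G' p.
  apply: (sub_in_cycle (P := mem p)) cp; last exact/allP.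
  by move=> x y /= xp yp ->; rewrite xp yp.
have /connectP[q eq qE] := connect_cycle cp' e1 e2.
(* The cycle leads from e.1, which contains j, to e.2, which does not. *)
have [||x [y [/and3P[xy xp yp] jx jy]]] :=
  path_exit (Q := fun x : cell T => j \in val x) eq.
- by case/andP: ej => _ /eqP ->; rewrite setU11.
- by rewrite -qE; case/andP: ej.
case/orP: xy => [|yxA]; last first.
  have [j' _ /andP[_ /eqP yE]] := dirA _ yxA.
  by case/negP: jy; rewrite [val y]yE inE jx orbT.
rewrite inE => /andP[xyA xycw].
have xyj : in_direction j (x, y).
  rewrite /in_direction jy /= eq_sym eqEcard subUset sub1set jx.
  move: xycw; rewrite inE => /andP[/= -> /eqP xy] /=.
  rewrite cardsU1 jy add1n; have := valP x; have := valP y.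
  rewrite -!card_gt0; move: xy => /=.
  by case: #|val x| => //; case: #|val y| => // a b /= ->.
have [e' [j' [e'A xye' j'j e'j']]] :=
  greedyA j (x, y) (ltn_ord j) xycw xyj (gr_p x y xp yp) xyA.
have : D j'.
  have e'p z : z \in p -> on_edge z e' -> e'.1 \in p /\ e'.2 \in p.
    move=> /inA[e'' [e''A ze'' p1 p2]] ze'.
    by rewrite (disA z e' e'' e'A e''A ze' ze'').
  apply/exists_inP; exists e' => //; rewrite e'j' /=.
  by apply/andP; case/orP: xye' => /=; [apply: e'p xp | apply: e'p yp].
by move/jmin; rewrite leqNgt j'j.
Qed.

End Pruning.

Theorem theorem3p4 (k : fieldType) (n r : nat) (m : r.-tuple 'X_{1..n}) :
  let A := pruned_edges m in
  let XA := morse_complex A in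
  [/\ is_matching A, acyclic A & homogeneous A] /\
  order_preserving XA /\
  supports_cellular_resolution XA (monomial_ideal (k := k) m).
Proof.
move=> A XA; have matchA := pruned_matching m.
have acyclicA := @pruned_acyclic n r m.
have homA := @pruned_homogeneous n r m.
have orderT := @taylor_order_preserving n r m.
have orderXA := morse_order_preserving orderT homA.
split=> //; split=> //; apply: supports_of_augmented => //.
apply: morse_augmented_resolution => //; first exact: pruned_unit.
exact: taylor_augmented_resolution.
Qed.
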